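(* Let $T=(T_m)_{m\in\mathbb Z}$ be an ergodic (probability preserving) $\mathbb Z$-action of rank at most $k$ without spacers, with refining sequence of $T$-castles satisfying the CO-condition. Suppose also that for all $n\ge0$ and $i,j\in\{1,\dots,k\}$, if a copy of the $i$-th $T$-tower from the $n$-th $T$-castle is contained inside the $j$-th $T$-tower from the $(n+1)$-th $T$-castle, then at least one more copy of the $i$-th $T$-tower is contained inside the $j$-th $T$-tower. Then $T$ is partially rigid.
   Context: Measure spaces are standard and non-atomic. **Rank at most $k$ without spacers.** A probability preserving $\mathbb Z$-action $T$ on $(X,\mathfrak B,\mu)$ is of rank at most $k$ without spacers if there are sequences $(B_n^j)_{n\ge0}$, $j=1,\dots,k$, of measurable subsets and sets $F_n^j=\{0,1,\dots,\#F_n^j-1\}$ such that: (i) for each $n$, the sets $T_gB_n^j$, $g\in F_n^j$, $1\le j\le k$, are pairwise disjoint and their union is $X$ mod $0$; (ii) for each $B\in\mathfrak B$, $\lim_{n\to\infty}\inf_{F^j\subset F_n^j}\mu\big(B\triangle\bigsqcup_{j=1}^k\bigsqcup_{g\in F^j}T_gB_n^j\big)=0$. The collection $\{T_gB_n^j: g\in F_n^j\}$ is the $j$-th $T$-tower of the $n$-th $T$-castle, its members are levels. The sequence of castles refines if every level of the $n$-th castle is a union of levels of the $(n+1)$-th castle, for each $n$. In this case every tower of the $(n+1)$-th castle is a stack of consecutive (sub-tower) copies of towers of the $n$-th castle. **CO-condition** (for $T$ of rank at most $k$ without spacers with refining castles): for all $n\ge0$ and $i,j,l\in\{1,\dots,k\}$,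 if a copy of the $l$-th $T$-tower from the $n$-th $T$-castle lies between two copies of the $i$-th $T$-tower inside the $j$-th $T$-tower of the $(n+1)$-th $T$-castle, then $l=i$. **Partial rigidity**: there are $\delta>0$ and an increasing sequence of integers $(m_n)$ such that $\liminf_{n\to\infty}\mu(A\cap T_{m_n}A)\ge\delta\mu(A)$ for each $A\in\mathfrak B$. *)

(* Defs.v *)
From HB Require Import structures.
From mathcomp Require Import all_boot all_order all_algebra.
From mathcomp Require Import all_classical all_reals all_analysis.

Set Implicit Arguments.
Unset Strict Implicit.
Unset Printing Implicit Defensive.

Import Order.TTheory GRing.Theory Num.Theory.
Import numFieldNormedType.Exports.

Local Open Scope classical_set_scope.
Local Open Scope ring_scope.

(* (X, measurable) is Borel isomorphic to a Polish space. *)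
Definition standard_borel (R : realType) (d : measure_display)
    (X : measurableType d) : Prop :=
  exists (Y : completePseudoMetricType R) (f : X -> Y),
    [/\ hausdorff_space Y, @second_countable Y, bijective f &
      forall A : set X,
        measurable A <-> <<s [set U : set Y | open U] >> (f @` A)].

Definition non_atomic (R : realType) (d : measure_display)
    (X : measurableType d) (mu : set X -> \bar R) : Prop :=
  forall A : set X, measurable A -> (0 < mu A)%E ->
    exists C : set X, [/\ measurable C, C `<=` A, (0 < mu C)%E &
      (mu C < mu A)%E].

Section ZAction.
Context (R : realType) (d : measure_display) (X : measurableType d).
Variables (mu : probability X R) (T : int -> X -> X).

Record pp_Zaction : Prop := PpZaction {
  Zaction0 : forall x, T 0 x = x ;
  ZactionD : forall (m n : int) x, T (m + n) x = T m (T n x) ;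
  Zaction_measurable : forall m : int, measurable_fun [set: X] (T m) ;
  Zaction_preserving : forall (m : int) (A : set X), measurable A ->
    mu (T m @^-1` A) = mu A }.

Definition ergodic_Zaction : Prop :=
  forall A : set X, measurable A -> (forall m : int, T m @` A = A) ->
    mu A = 0%E \/ mu A = 1%E.

Definition partially_rigid : Prop :=
  exists2 delta : R, 0 < delta &
  exists2 m : nat -> int, (forall n, m n < m n.+1) &
    forall A : set X, measurable A ->
      (delta%:E * mu A <= limn_einf (fun n => mu (A `&` (T (m n) @` A))))%E.

Section Castles.
(* B n j is the base and h n j the number of levels of the j-th tower of the
   n-th castle: F_n^j = {0, ..., h n j - 1}.  Towers may be empty or null. *)
Variables (k : nat) (B : nat -> 'I_k -> set X) (h : nat -> 'I_k -> nat).

Definition level (n : nat) (j : 'I_k) (g : nat) : set X :=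
  T (Posz g) @` B n j.

Definition is_level (n : nat) (a : 'I_k * nat) : Prop := (a.2 < h n a.1)%N.

Definition levels_union (n : nat) (F : 'I_k -> set nat) : set X :=
  \bigcup_(j in [set: 'I_k]) \bigcup_(g in F j) level n j g.

Record rank_le_without_spacers : Prop := RankLeWithoutSpacers {
  base_measurable : forall n j, measurable (B n j) ;
  castle_disjoint : forall n,
    trivIset [set a | is_level n a] (fun a => level n a.1 a.2) ;
  castle_cover : forall n,
    mu (~` levels_union n (fun j => `I_(h n j))) = 0%E ;
  castle_approx : forall A : set X, measurable A ->
    (fun n => ereal_inf [set mu (A `+` levels_union n F) |
        F in [set F : 'I_k -> set nat | forall j, F j `<=` `I_(h n j)]])
      @ \oo --> 0%E }.

(* Levels p, ..., p + h n l - 1 of the j-th tower of castle n.+1 run through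
   the levels of the l-th tower of castle n (inclusions are mod 0).  As
   inclusions of null sets carry no information, a null tower contains no
   copy. *)
Definition copy_at (n : nat) (l j : 'I_k) (p : nat) : Prop :=
  [/\ (0 < mu (B n.+1 j))%E, (0 < h n l)%N, (p + h n l <= h n.+1 j)%N &
    forall g, (g < h n l)%N ->
      mu (level n.+1 j (p + g) `\` level n l g) = 0%E].

(* The second component says that every (non-null) tower of castle n.+1 is a
   stack of copies of towers of castle n; distinct copies cannot overlap since
   levels are disjoint.  It is not implied by the first one: shifting all bases
   of castle n.+1 by the same T_m keeps the first but may break the second. *)
Definition refining : Prop :=
  forall n,
    (forall l g, (g < h n l)%N ->
       exists2 F : 'I_k -> set nat, (forall j, F j `<=` `I_(h n.+1 j)) &
         mu (level n l g `+` levels_union n.+1 F) = 0%E) /\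
    (forall j q, (0 < mu (B n.+1 j))%E -> (q < h n.+1 j)%N ->
       exists l p, copy_at n l j p /\ (p <= q < p + h n l)%N).

Definition CO_condition : Prop :=
  forall n (i j l : 'I_k) (p q r : nat),
    copy_at n i j p -> copy_at n l j q -> copy_at n i j r ->
    (p < q < r)%N -> l = i.

Definition copies_repeat : Prop :=
  forall n (i j : 'I_k) (p : nat), copy_at n i j p ->
    exists2 q : nat, q <> p & copy_at n i j q.

End Castles.
End ZAction.

(* Main.v *)
Require Import Defs.
From HB Require Import structures.
From mathcomp Require Import all_boot all_order all_algebra.
From mathcomp Require Import all_classical all_reals all_analysis.
From mathcomp Require Import zify ring lra.

(* In a tower of the (n+1)-st castle the CO-condition makes the copies of the
   i-th tower of the n-th castle consecutive, and by the repetition hypothesis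
   there are none or at least two.  So all but the lowest copy lie directly on
   top of another one, whence mu(L & T_h L) >= mu(L) / 2 for every level L of
   the i-th tower, h being its height, and asymptotically
   mu(A & T_h A) >= mu(A & Y) / 2, where Y is the i-th tower.  Choose i = i_n
   with mu(Y_n) >= 1/k.  Heights tend to infinity, so Y_n is asymptotically
   invariant and, T being ergodic, mu(A & Y_n) - mu(A) mu(Y_n) -> 0; thus
   delta = 1/(2k) works.  For the last limit, let kappa(A) be the limit of
   mu(A & Y_n) - mu(A) mu(Y_n) along an ultrafilter.  It is a T-invariant charge
   dominated by mu with kappa(X) = 0; the T-saturation of the negative set of a
   Hahn decomposition of kappa is invariant and negative, hence null or conull,
   so kappa has constant sign and vanishes. *)

Set Implicit Arguments.
Unset Strict Implicit.
Unset Printing Implicit Defensive.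

Import Order.TTheory GRing.Theory Num.Theory.
Import numFieldNormedType.Exports.

Local Open Scope classical_set_scope.
Local Open Scope ring_scope.

(** * Real-valued probabilities and dominated set functions *)

Section FineMeasure.
Context {R : realType} {d : measure_display} {X : measurableType d}.
Variable mu : probability X R.

Local Notation pr A := (fine (mu A)).

Lemma fine_muK A : measurable A -> mu A = (pr A)%:E.
Proof. by move=> mA; rewrite fineK// fin_num_measure. Qed.

Lemma pr_ge0 A : 0 <= pr A.
Proof. by rewrite fine_ge0. Qed.

Lemma prU A B : measurable A -> measurable B -> A `&` B = set0 ->
  pr (A `|` B) = pr A + pr B.
Proof.
by move=> mA mB AB; rewrite measureU// fineD// fin_num_measure.
Qed.

Lemma le_pr A B : measurable A -> measurable B -> A `<=` B -> pr A <= pr B.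
Proof.
move=> mA mB AB; apply: fine_le; rewrite ?fin_num_measure//.
by apply: le_measure; rewrite ?inE.
Qed.

Lemma prDI A B : measurable A -> measurable B ->
  pr A = pr (A `\` B) + pr (A `&` B).
Proof.
move=> mA mB; rewrite -prU//.
- by rewrite setUC setUIDK.
- exact: measurableD.
- exact: measurableI.
- by rewrite setDE setIACA setICl setI0.
Qed.

Lemma pr_leU A B : measurable A -> measurable B ->
  pr (A `|` B) <= pr A + pr B.
Proof.
move=> mA mB; have mBA : measurable (B `\` A) by exact: measurableD.
have -> : A `|` B = A `|` (B `\` A).
  apply/seteqP; split => x [|]; [by left| |by left|by case; right].
  by have [] := pselect (A x); [left|right].
rewrite prU//; last by rewrite setDE setICA setICr setI0.
by rewrite lerD2l le_pr// => x [].
Qed.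

Lemma prT : pr setT = 1.
Proof. by rewrite probability_setT. Qed.

Lemma pr0 : pr set0 = 0.
Proof. by rewrite measure0. Qed.

Lemma additive_bigcup (kappa : set X -> R) (F : nat -> set X) n :
  kappa set0 = 0 ->
  (forall A B, measurable A -> measurable B -> A `&` B = set0 ->
    kappa (A `|` B) = kappa A + kappa B) ->
  (forall i, measurable (F i)) -> trivIset setT F ->
  kappa (\big[setU/set0]_(i < n) F i) = \sum_(0 <= i < n) kappa (F i).
Proof.
move=> k0 kU mF tF; elim: n => [|n IH]; first by rewrite big_ord0 big_geq.
rewrite big_ord_recr big_nat_recr//= -IH kU//.
- by apply: bigsetU_measurable.
- rewrite -subset0 -bigcup_mkord => x [[i /= ni Fi] Fn].
  by move: ni; rewrite (tF i n)//= ?ltnn//; exists x.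
Qed.

(** By additivity the error after [n] terms is [kappa] of the remaining tail. Domination bounds it
    by [C] times the [mu]-mass of that tail, which tends to 0 because [mu] is sigma-additive. *)
Lemma dominated_sigma_additive (kappa : set X -> R) (C : R) :
  (forall A B, measurable A -> measurable B -> A `&` B = set0 ->
    kappa (A `|` B) = kappa A + kappa B) ->
  (forall A, measurable A -> `|kappa A| <= C * pr A) ->
  semi_sigma_additive (fun A => (kappa A)%:E).
Proof.
move=> kU kle F mF tF mU.
have k0 : kappa set0 = 0.
  by apply/eqP; rewrite -normr_le0 (le_trans (kle _ _))// pr0 mulr0.
under eq_fun do rewrite sumEFin -additive_bigcup//.
apply: cvg_EFin; first exact: nearW.
pose S n := \big[setU/set0]_(i < n) F i.
have mS n : measurable (S n) by exact: bigsetU_measurable.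
have SU n : S n `<=` \bigcup_n F n.
  by rewrite /S -bigcup_mkord; apply: bigcup_sub => i _; exact: bigcup_sup.
have muS : (fun n => pr (S n)) @ \oo --> pr (\bigcup_n F n).
  have := @measure_semi_sigma_additive _ _ _ mu F mF tF mU.
  under eq_fun do rewrite big_mkord -measure_bigsetU//.
  by move=> muU; apply: fine_cvg; rewrite -fine_muK.
apply/subr_cvg0/norm_cvg0P.
apply: (@squeeze_cvgr _ _ _ _ (cst 0)
  (fun n => C * (pr (\bigcup_n F n) - pr (S n)))).
- apply: nearW => n /=; rewrite normr_ge0/=.
  have SI : \bigcup_n F n `&` S n = S n by exact/setIidPr.
  rewrite (prDI mU (mS n)) SI addrK.
  have -> : kappa (\bigcup_n F n) =
      kappa (\bigcup_n F n `\` S n) + kappa (S n).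
    rewrite -kU//; first by rewrite setUC setDUK.
      exact: measurableD.
    by rewrite setDE -setIA setICl setI0.
  by rewrite distrC addrK kle//; exact: measurableD.
- exact: cvg_cst.
- rewrite -[X in _ --> X](mulr0 C) -(subrr (pr (\bigcup_n F n))).
  by apply: cvgMr; apply: cvgB muS; exact: cvg_cst.
Qed.
End FineMeasure.

(** * Images under the action and invariant charges *)

Section ZactionTheory.
Context {R : realType} {d : measure_display} {X : measurableType d}.
Variables (mu : probability X R) (T : int -> X -> X).
Hypothesis actT : pp_Zaction mu T.

Local Notation pr A := (fine (mu A)).

Lemma image_Zaction m A : T m @` A = T (- m) @^-1` A.
Proof.
have [T0 TD _ _] := actT; apply/seteqP; split => [_ [x Ax <-]|x Ax] /=.
  by rewrite -TD addNr T0.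
by exists (T (- m) x) => //; rewrite -TD subrr T0.
Qed.

Lemma measurable_Zaction m A : measurable A -> measurable (T m @` A).
Proof.
move=> mA; rewrite image_Zaction -[X in measurable X]setTI.
exact: (Zaction_measurable actT).
Qed.

Lemma mu_Zaction m A : measurable A -> mu (T m @` A) = mu A.
Proof. by move=> mA; rewrite image_Zaction (Zaction_preserving actT). Qed.

Lemma Zaction_image0 A : T 0 @` A = A.
Proof.
rewrite image_Zaction oppr0.
by apply/seteqP; split=> x /=; rewrite (Zaction0 actT).
Qed.

Lemma Zaction_imageD m n A : T (m + n) @` A = T m @` (T n @` A).
Proof.
rewrite !image_Zaction -comp_preimage.
suff -> : T (- (m + n)) = T (- n) \o T (- m) by [].
by apply/funext => x /=; rewrite -(ZactionD actT) opprD addrC.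
Qed.

Lemma Zaction_imageI m A A' : T m @` (A `&` A') = T m @` A `&` T m @` A'.
Proof. by rewrite !image_Zaction preimage_setI. Qed.

Lemma Zaction_imageB m A A' : T m @` (A `\` A') = T m @` A `\` T m @` A'.
Proof. by rewrite !image_Zaction !setDE preimage_setI preimage_setC. Qed.

(** The saturation [N'] of a Hahn negative set [N] is invariant and still negative. If it is null,
    [nu] lives on the positive set; if it is conull, [nu] lives on [N']. Either way [nu] has
    constant sign and total mass 0. *)
Lemma ergodic_charge_eq0 (nu : {charge set X -> \bar R}) :
  ergodic_Zaction mu T ->
  nu setT = 0%E ->
  (forall A, measurable A -> mu A = 0%E -> nu A = 0%E) ->
  (forall m A, measurable A -> nu (T m @` A) = nu A) ->
  forall A, measurable A -> nu A = 0%E.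
Proof.
move=> ergT nuT nu_dom nu_inv.
have [P [N [[mP posP] [mN negN] PN _]]] := Hahn_decomposition nu.
have negTN m : negative_set nu (T m @` N).
  split=> [|E mE EN]; first exact: measurable_Zaction.
  rewrite -(nu_inv (- m)) //; apply: negN; first exact: measurable_Zaction.
  by rewrite -(Zaction_image0 N) -(addNr m) Zaction_imageD; exact: image_subset.
(* [Z] enumerates the integers, so that the saturation is a countable union; indices that decode to
   nothing give 0, which is harmless in a union. *)
pose Z (i : nat) : int := odflt 0 (unpickle i).
pose N' := \bigcup_i T (Z i) @` N.
have [mN' negN'] : negative_set nu N' by exact: bigcup_negative_set.
have N'P m x : N x -> N' (T m x).
  by move=> Nx; exists (pickle m) => //; rewrite /Z pickleK; exists x.
have N'inv m : T m @` N' = N'.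
  have sub m' : T m' @` N' `<=` N'.
    by move=> _ [_ [i _ [x Nx <-]] <-]; rewrite -(ZactionD actT); exact: N'P.
  apply/seteqP; split => // x N'x; exists (T (- m) x).
    by apply: (sub (- m)); exists x.
  by rewrite -(ZactionD actT) subrr (Zaction0 actT).
have nuC A : measurable A -> nu A = (- nu (~` A))%E.
  move=> mA; have := chargeU nu mA (measurableC mA) (setICr A).
  rewrite setUCr nuT => /esym/eqP.
  have := fin_num_measure nu _ mA.
  have := fin_num_measure nu _ (measurableC mA).
  move: (nu A) (nu (~` A)) => [a| |] [b| |]// _ _.
  by rewrite -EFinD -EFinN => /eqP[]/eqP; rewrite addr_eq0 => /eqP ->.
(* Since [nu] of a complement is the opposite of [nu], a constant sign in either direction forces
   [nu] to vanish. *)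
suff one_sign (s : bool) :
    (forall A, measurable A ->
      if s then (0 <= nu A)%E else (nu A <= 0)%E) ->
    forall A, measurable A -> nu A = 0%E.
  have N'N : N `<=` N' by move=> x Nx; rewrite -(Zaction0 actT x); exact: N'P.
  have [N'0|N'1] := ergT N' mN' N'inv.
    apply: (one_sign true) => A mA; rewrite (chargeDI nu mA mN).
    have mAN : measurable (A `&` N) by exact: measurableI.
    have -> : nu (A `&` N) = 0%E.
      apply: nu_dom => //.
      by apply: (@subset_measure0 _ _ _ mu _ N') => // x [_ /N'N].
    rewrite adde0; apply: posP; first exact: measurableD.
    by move=> x [Ax Nx]; have : (P `|` N) x by [rewrite PN]; case.
  apply: (one_sign false) => A mA; rewrite (chargeDI nu mA mN').
  have mAN : measurable (A `\` N') by exact: measurableD.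
  have -> : nu (A `\` N') = 0%E.
    apply: nu_dom => //; apply: (@subset_measure0 _ _ _ mu _ (~` N')) => //.
    - exact: measurableC.
    - by rewrite [LHS]probability_setC// N'1 subee.
  by rewrite add0e negN'//; exact: measurableI.
case: s => sgn A mA; apply/eqP; rewrite eq_le sgn// ?andbT /=.
  by rewrite nuC// oppe_le0 sgn//; exact: measurableC.
by rewrite nuC// oppe_ge0 sgn//; exact: measurableC.
Qed.

End ZactionTheory.

(** * Asymptotic independence from almost invariant sets *)

Section AlmostInvariant.
Context {R : realType} {d : measure_display} {X : measurableType d}.
Variables (mu : probability X R) (T : int -> X -> X).
Hypothesis actT : pp_Zaction mu T.
Variable Y : nat -> set X.
Hypothesis mY : forall n, measurable (Y n).

Local Notation pr A := (fine (mu A)).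

Let dev A n := pr (A `&` Y n) - pr (Y n) * pr A.

Let devU A B n : measurable A -> measurable B -> A `&` B = set0 ->
  dev (A `|` B) n = dev A n + dev B n.
Proof.
move=> mA mB AB; rewrite /dev prU// setIUl prU; first by ring.
- exact: measurableI.
- exact: measurableI.
- by rewrite setIACA AB set0I.
Qed.

Let dev_le A n : measurable A -> `|dev A n| <= pr A.
Proof.
move=> mA; rewrite /dev ler_norml.
have := pr_ge0 mu (A `&` Y n).
have : pr (A `&` Y n) <= pr A by apply: le_pr => //; exact: measurableI.
have := pr_ge0 mu A.
have : pr (Y n) <= 1 by rewrite -(prT mu); exact: le_pr.
have := pr_ge0 mu (Y n).
move: (pr _) (pr (Y n)) (pr A) => a b c *; nra.
Qed.

Let devT n : dev setT n = 0.
Proof. by rewrite /dev prT setTI mulr1 subrr. Qed.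

(** As [T 1] preserves [mu], shifting [A] amounts to comparing the traces of [Y n] and of [T 1 @] Y
    n[on the same set]T 1 @[A]. *)
Let dev_shift A n : measurable A ->
  `|dev (T 1 @` A) n - dev A n| <= pr (T 1 @` Y n `\` Y n).
Proof.
move=> mA; have mT B : measurable B -> measurable (T 1 @` B).
  exact: measurable_Zaction actT _ _.
have prT1 B : measurable B -> pr (T 1 @` B) = pr B.
  by move=> mB; rewrite (mu_Zaction actT).
have -> : dev (T 1 @` A) n - dev A n =
    pr (T 1 @` A `&` Y n) - pr (T 1 @` A `&` T 1 @` Y n).
  rewrite /dev (prT1 A)// -(Zaction_imageI actT) (prT1 (A `&` Y n)).
    by ring.
  exact: measurableI.
have mTA := mT _ mA; have mTY := mT _ (mY n).
(* Two sets of equal mass have one-sided differences of equal mass, so a single difference controls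
   both signs. *)
have YT : pr (Y n `\` T 1 @` Y n) = pr (T 1 @` Y n `\` Y n).
  have := prDI mu (mY n) mTY; have := prDI mu mTY (mY n).
  rewrite prT1// setIC; lra.
have le1 U V W : measurable U -> measurable V -> measurable W ->
    pr (W `&` U) <= pr (W `&` V) + pr (U `\` V).
  move=> mU mV mW; rewrite (prDI mu (measurableI _ _ mW mU) mV) addrC lerD//.
    by apply: le_pr => [||x [[]]//]; repeat apply: measurableI.
  apply: le_pr => [||x [[]]//]; repeat apply: measurableD => //.
  exact: measurableI.
have := le1 _ _ _ (mY n) mTY mTA; have := le1 _ _ _ mTY (mY n) mTA.
rewrite ler_norml YT; lra.
Qed.

Lemma almost_invariant_independent : ergodic_Zaction mu T ->
  (fun n => pr (T 1 @` Y n `\` Y n)) @ \oo --> 0 ->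
  forall A, measurable A ->
  (fun n => pr (A `&` Y n) - pr (Y n) * pr A) @ \oo --> 0.
Proof.
move=> ergT Yinv A mA; rewrite -/(dev A); apply/cvgr0Pnorm_lt => e e0.
apply: contrapT => Ae.
(* Were the limit to fail for [e], the bad indices [S] would be infinite. The restriction of the
   filter at infinity to [S] is then proper and extends to an ultrafilter [U], along which the
   deviation of [A] stays at least [e]. *)
pose S := [set n | e <= `|dev A n|].
have G_proper : ProperFilter (within S \oo).
  apply: Build_ProperFilter_ex => B SB; apply: contrapT => B0; apply: Ae.
  have {}SB : \forall n \near \oo, S n -> B n by exact: SB.
  apply: filterS SB => n Bn /=; rewrite ltNge; apply/negP => en.
  by apply: B0; exists n; exact: Bn.
have [U [UU GU]] := ultraFilterLemma G_proper.
have PU : ProperFilter U by exact: ultra_proper.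
have Uoo (B : set nat) : (\forall n \near \oo, B n) -> U B.
  by move=> ooB; apply: GU; apply: filterS ooB.
pose kappa B := lim (dev B @ U).
have kappaP B : measurable B -> dev B @ U --> kappa B.
  move=> mB; apply/cvg_ex.
  (* The deviations lie in the compact interval [-1, 1], so they cluster along [U], and an
     ultrafilter converges to its cluster points. *)
  have dev1 : U (dev B @^-1` `[-1, 1]%classic).
    apply: Uoo; apply: nearW => n /=; rewrite in_itv /= -ler_norml.
    by rewrite (le_trans (dev_le n mB))// -(prT mu) le_pr.
  have [l [_ lP]] := @segment_compact R (- 1) 1 (dev B @ U) _ dev1.
  exists l => V lV; have [//|nV] := in_ultra_setVsetC (dev B @^-1` V) UU.
  by have [x []] := lP (~` V) V nV lV.
have kappaE B l : measurable B -> dev B @ U --> l -> kappa B = l.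
  by move=> mB; exact: cvg_lim.
have kappaU B C : measurable B -> measurable C -> B `&` C = set0 ->
    kappa (B `|` C) = kappa B + kappa C.
  move=> mB mC BC; apply: kappaE; first exact: measurableU.
  have -> : dev (B `|` C) = dev B + dev C by apply/funext => n; exact: devU.
  by apply: cvgD; exact: kappaP.
have kappa_le B : measurable B -> `|kappa B| <= 1 * pr B.
  move=> mB; rewrite mul1r; apply: (cvgr_to_le (cvg_norm (kappaP _ mB))).
  by apply: nearW => n; exact: dev_le.
have kappa0 : kappa set0 = 0.
  by apply/eqP; rewrite -normr_le0 (le_trans (kappa_le _ _))// pr0 mulr0.
have kappaT : kappa setT = 0.
  apply: kappaE => //; rewrite (_ : dev setT = cst 0); first exact: cvg_cst.
  by apply/funext => n; exact: devT.
(* By [dev_shift] the deviations of [B] and of its shift differ by a quantity tending to 0, hence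
   have the same limit along [U]. *)
have kappaT1 B : measurable B -> kappa (T 1 @` B) = kappa B.
  move=> mB; have mTB := measurable_Zaction actT 1 mB.
  apply: kappaE => //.
  suff d0 : (fun n => dev (T 1 @` B) n - dev B n) @ U --> 0.
    exact: cvg_sub0 d0 (kappaP _ mB).
  apply/norm_cvg0P; apply: (@squeeze_cvgr _ _ _ _ (cst 0)
    (fun n => pr (T 1 @` Y n `\` Y n))).
  - by apply: nearW => n; rewrite normr_ge0 dev_shift.
  - exact: cvg_cst.
  - by move=> B' /Yinv; exact: Uoo.
have kappaTm m B : measurable B -> kappa (T m @` B) = kappa B.
  elim/int_rect: m B => [B _|m IH B mB|m IH B mB].
  - by rewrite (Zaction_image0 actT).
  - rewrite intS (Zaction_imageD actT) kappaT1 ?IH//.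
    exact: (measurable_Zaction actT).
  - have mTB := measurable_Zaction actT (- m.+1%:Z) mB.
    rewrite -(kappaT1 _ mTB) -(Zaction_imageD actT) intS opprD addrA.
    by rewrite subrr add0r IH.
pose nu := fun B => (kappa B)%:E.
have nu_sigma : semi_sigma_additive nu.
  exact: dominated_sigma_additive kappa_le.
have nu0 : nu set0 = 0%E by rewrite /nu kappa0.
have nu_fin B : measurable B -> nu B \is a fin_num by [].
pose nuC : {charge set X -> \bar R} :=
  HB.pack nu (isCharge.Build _ _ _ nu nu0 nu_fin nu_sigma).
have nu_eq0 : nu A = 0%E.
  apply: (@ergodic_charge_eq0 _ _ _ mu T actT nuC) => //.
  - by rewrite /= /nu kappaT.
  - move=> B mB B0; rewrite /= /nu; congr EFin; apply/eqP.
    by rewrite -normr_le0 (le_trans (kappa_le _ mB))// B0 mulr0.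
  - by move=> m B mB; rewrite /= /nu kappaTm.
have : e <= `|kappa A|.
  apply: (cvgr_to_ge (cvg_norm (kappaP _ mA))).
  by apply: GU; apply: nearW.
by case: nu_eq0 => ->; rewrite normr0 leNgt e0.
Qed.

End AlmostInvariant.

(** * Finite additivity over indexed disjoint families *)

Section FiniteDisjointSums.
Context {R : realType} {d : measure_display} {X : measurableType d}.
Variable mu : probability X R.
Context {I : finType} {P : pred I} {E : I -> set X}.
Hypothesis mE : forall i, measurable (E i).
Hypothesis disjE : forall i j x, P i -> P j -> E i x -> E j x -> i = j.

Local Notation pr A := (fine (mu A)).

Lemma pr_bigcup_fin :
  pr (\bigcup_(i in [set i | P i]) E i) = \sum_(i | P i) pr (E i).
Proof.
have -> : [set i | P i] = [set i | (i \in index_enum I) && P i].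
  by apply/seteqP; split => i /=; rewrite mem_index_enum.
rewrite bigcup_seq_cond.
elim: (index_enum I) (index_enum_uniq I) => [|a s IH].
  by rewrite !big_nil pr0.
rewrite /= !big_cons => /andP[as_ us]; case: ifPn => Pa; last by rewrite IH.
rewrite prU ?IH//; first exact: bigsetU_measurable.
rewrite -bigcup_seq_cond -subset0 => x [Ea [i /= /andP[si Pi] Ei]].
by move: as_; rewrite (disjE Pa Pi Ea Ei) si.
Qed.

End FiniteDisjointSums.

(** * Levels of castles and copies of towers *)

Section Castle.
Context {R : realType} {d : measure_display} {X : measurableType d}.
Variables (mu : probability X R) (T : int -> X -> X) (k : nat).
Variables (B : nat -> 'I_k -> set X) (h : nat -> 'I_k -> nat).
Hypothesis actT : pp_Zaction mu T.
Hypothesis rankT : rank_le_without_spacers mu T B h.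

Local Notation pr A := (fine (mu A)).
Local Notation lev := (level T B).
Local Notation copy := (copy_at mu T B h).

Lemma measurable_level n j g : measurable (lev n j g).
Proof. exact/(measurable_Zaction actT)/(base_measurable rankT). Qed.
#[local] Hint Resolve measurable_level : core.

Lemma mu_level n j g : mu (lev n j g) = mu (B n j).
Proof. exact/(mu_Zaction actT)/(base_measurable rankT). Qed.

Lemma Zaction_level n j (m g : nat) : T m @` lev n j g = lev n j (m + g).
Proof. by rewrite /level -(Zaction_imageD actT) PoszD. Qed.

Lemma level_inj n j g j' g' x : (g < h n j)%N -> (g' < h n j')%N ->
  lev n j g x -> lev n j' g' x -> (j, g) = (j', g').
Proof.
move=> gh gh' Lx Lx'.
apply: (castle_disjoint rankT (n := n) (i := (j, g)) (j := (j', g'))) => //.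
by exists x.
Qed.

(** Copies are inclusions mod 0, so disjointness of levels has to be used through measure: a common
    level of castle [n.+1] is non-null and lies mod 0 in both levels of castle [n]. These therefore
    meet, and so coincide. *)
Lemma copy_inj n l l' j p p' g g' : copy n l j p -> copy n l' j p' ->
  (g < h n l)%N -> (g' < h n l')%N -> (p + g = p' + g')%N -> (l, g) = (l', g').
Proof.
move=> [B0 _ _ sub] [_ _ _ sub'] gh gh' pg.
suff [x [Lx Lx']] : lev n l g `&` lev n l' g' !=set0 by exact: level_inj Lx Lx'.
apply/set0P; apply/eqP => disj.
have := sub _ gh; have := sub' _ gh'; rewrite -pg; set E := lev _ _ _ => E' E0.
have : mu E = 0%E.
  apply: (@subset_measure0 _ _ _ mu _
    ((E `\` lev n l' g') `|` (E `\` lev n l g))).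
  - exact: measurable_level.
  - by apply: measurableU; apply: measurableD => //; exact: measurable_level.
  - move=> x Ex; have [Lx|] := pselect (lev n l g x); last by right.
    by left; split => // Lx'; have : set0 x by rewrite -disj.
  - by rewrite [LHS]measureU0//; apply: measurableD => //;
      exact: measurable_level.
by rewrite mu_level => Bn0; rewrite Bn0 ltxx in B0.
Qed.

(** * Consecutive copies under the CO-condition *)

Hypothesis refT : refining mu T B h.
Hypothesis coT : CO_condition mu T B h.
Hypothesis repT : copies_repeat mu T B h.

(** Level [r.-1] lies in some copy, starting at [q], which must end exactly at [r] since copies do
    not overlap. If [p < q], the CO-condition makes it a copy of tower [l]; otherwise it covers
    level [p], so it is the copy at [p] itself. *)
Lemma copy_pred n l j p r : copy n l j p -> copy n l j r -> (p < r)%N ->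
  (h n l <= r)%N /\ copy n l j (r - h n l).
Proof.
move=> cp cr pr_lt.
have [Bj hl rh _] := cr.
have [|l' [q [cq /andP[qr rq]]]] := (refT n).2 j r.-1 Bj; first by lia.
have {rq} : (r <= q + h n l')%N by lia.
have {qr} : (q < r)%N by lia.
move=> qr; rewrite leq_eqVlt => /orP[/eqP rE|rq]; last first.
  have : (l, 0%N) = (l', (r - q)%N) by apply: copy_inj cr cq hl _ _; lia.
  by case; lia.
have [pq|qp] := ltnP p q.
  have ll' : l' = l by apply: coT cp cq cr _; rewrite pq.
  by move: rE cq; rewrite ll' => ->; rewrite addnK leq_addl.
have : (l, 0%N) = (l', (p - q)%N) by apply: copy_inj cp cq hl _ _; lia.
move=> [ll' pq]; have {pq} qE : q = p by lia.
by move: rE cq; rewrite -ll' => ->; rewrite addnK leq_addl.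
Qed.

(** A common bound on the heights lets all levels of a castle be indexed by one finite product type,
    with a predicate cutting off the excess. *)
Let maxh n := \max_j h n j.

Lemma ltn_maxh n j q : (q < h n j)%N -> (q < maxh n)%N.
Proof. by move=> qh; apply: leq_trans qh (leq_bigmax _). Qed.

(** * Decomposition along levels and returns of a level *)

Lemma sum_levels n Z (Q : pred ('I_k * 'I_(maxh n))) : measurable Z ->
  (forall p, Q p -> (p.2 < h n p.1)%N) ->
  \sum_(p | Q p) pr (Z `&` lev n p.1 p.2) =
  pr (\bigcup_(p in [set p | Q p]) (Z `&` lev n p.1 p.2)).
Proof.
move=> mZ Qh; rewrite (@pr_bigcup_fin _ _ _ mu _ Q)// =>
  [p|p p' x Qp Qp' [_ Lx] [_ Lx']].
  exact: measurableI.
have := level_inj (Qh _ Qp) (Qh _ Qp') Lx Lx'.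
by case: p p' {Qp Qp' Lx Lx'} => [a b] [a' b'] [/= -> /val_inj ->].
Qed.

Lemma sum_levels_le n Z (Q : pred ('I_k * 'I_(maxh n))) : measurable Z ->
  (forall p, Q p -> (p.2 < h n p.1)%N) ->
  \sum_(p | Q p) pr (Z `&` lev n p.1 p.2) <= pr Z.
Proof.
move=> mZ Qh; rewrite sum_levels//; apply: le_pr => //.
  apply: fin_bigcup_measurable => [|p _]; first exact: finite_finset.
  exact: measurableI.
by apply: bigcup_sub => p _ x [].
Qed.

Lemma sum_levels_eq n Z : measurable Z ->
  pr Z = \sum_(p : 'I_k * 'I_(maxh n) | (p.2 < h n p.1)%N)
    pr (Z `&` lev n p.1 p.2).
Proof.
move=> mZ; rewrite sum_levels// -setI_bigcupr.
set U := \bigcup_(p in _) _.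
have mU : measurable U.
  by apply: fin_bigcup_measurable => [|p _]; [exact: finite_finset|].
rewrite (prDI mu mZ mU) [X in X + _](_ : _ = 0) ?add0r//.
rewrite (_ : mu _ = 0%E)//.
apply: (@subset_measure0 _ _ _ mu _ (~` U)).
- exact: measurableD.
- exact: measurableC.
- by move=> x [].
rewrite -(castle_cover rankT n); congr (mu (~` _)).
apply/seteqP; split => [x [p ph Lx]|x [j _ [g gh Lx]]].
  by exists p.1 => //; exists p.2.
by exists (j, Ordinal (ltn_maxh gh)).
Qed.

(* Level q of tower j of castle n.+1 is the g-th level of a copy of the l-th
   tower; for returns, this copy moreover sits directly on top of another. *)
Let occurs n l j g q := (g <= q)%N && `[< copy n l j (q - g) >].

Let returns n l j g q := [&& occurs n l j g q, (h n l + g <= q)%N &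
  `[< copy n l j (q - g - h n l) >]].

(** By [copy_pred] every occurrence except the lowest, [q1], is a return. The repetition hypothesis
    supplies a second occurrence, so there is at least one return, and [1 + r <= 2 * r] for
    [r > 0]. *)
Lemma card_copies_le n l j g : (g < h n l)%N ->
  (#|[pred q : 'I_(maxh n.+1) | occurs n l j g q]| <=
    2 * #|[pred q : 'I_(maxh n.+1) | returns n l j g q]|)%N.
Proof.
move=> gh; set Q := occurs n l j g; set Q' := returns n l j g.
have [->//|/card_gt0P[q0 Qq0]] := posnP #|[pred q : 'I_(maxh n.+1) | Q q]|.
have [q1 Qq1 minq1] := arg_minnP (P := [pred q : 'I_(maxh n.+1) | Q q]) val Qq0.
have [q2 Qq2 q12] : exists2 q2 : 'I_(maxh n.+1), Q q2 & q2 != q1.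
  have /andP[gq1 /asboolP cq1] := Qq1.
  have [p pq1 cp] := repT cq1; have [_ _ ph _] := cp.
  have pM : (p + g < maxh n.+1)%N by apply: (@ltn_maxh _ j); lia.
  exists (Ordinal pM).
    by rewrite /Q /occurs /= addnK leq_addl; apply/asboolP.
  by apply/eqP => q1E; apply: pq1; rewrite -q1E /= addnK.
have sub (q : 'I_(maxh n.+1)) : Q q -> q != q1 -> Q' q.
  move=> Qq qq1; have ltq : (q1 < q)%N.
    by rewrite ltn_neqAle (minq1 _ Qq) andbT eq_sym.
  have /andP[gq1 /asboolP cq1] := Qq1; have /andP[gq /asboolP cq] := Qq.
  have [|hq cq'] := copy_pred cq1 cq; first by lia.
  rewrite /Q' /returns [X in X && _]Qq /=.
  by apply/andP; split; [lia|exact/asboolP].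
have le1 : (#|[pred q : 'I_(maxh n.+1) | Q q]| <=
    1 + #|[pred q : 'I_(maxh n.+1) | Q' q]|)%N.
  rewrite (cardD1 q1); apply: leq_add; first exact: leq_b1.
  apply/subset_leq_card/fintype.subsetP => q; rewrite !inE => /andP[qq1 Qq].
  exact: sub.
suff : (0 < #|[pred q : 'I_(maxh n.+1) | Q' q]|)%N by lia.
by apply/card_gt0P; exists q2; exact: sub.
Qed.

(** Both sides are decomposed along castle [n.+1]: the mass of the level is at most the sum of [b j]
    over its occurrences, that of the return set at least the sum of [b j] over the returns. In each
    tower [card_copies_le] compares the two counts. *)
Lemma level_return n l g : (g < h n l)%N ->
  pr (lev n l g) <= 2 * pr (lev n l g `&` T (h n l) @` lev n l g).
Proof.
move=> gh; set L := lev n l g; set Z := _ `&` _.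
have mL : measurable L by exact: measurable_level.
have mTL : measurable (T (h n l) @` L) by exact: (measurable_Zaction actT).
have mZ : measurable Z by exact: measurableI.
pose Q j := occurs n l j g; pose Q' j := returns n l j g.
pose b j := pr (B n.+1 j).
have Qh j q : Q j q -> (q < h n.+1 j)%N.
  by move=> /andP[gq /asboolP[_ _ qh _]]; lia.
have leL : pr L <= \sum_(p : 'I_k * 'I_(maxh n.+1) | Q p.1 p.2) b p.1.
  rewrite (@sum_levels_eq n.+1)// (bigID (fun p : 'I_k * 'I__ => Q p.1 p.2)) /=.
  rewrite [X in _ + X]big1 ?addr0 => [|[j q] /= /andP[qh nQ]].
    rewrite (eq_bigl (fun p : 'I_k * 'I__ => Q p.1 p.2)) => [|p]; last first.
      by case: (boolP (Q _ _)) => [/Qh ->|]; rewrite ?andbF.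
    apply: ler_sum => p _; rewrite /b -(mu_level _ _ p.2).
    by apply: le_pr => //; apply: measurableI.
  (* A level of castle [n.+1] that is not an occurrence contributes nothing: its tower is null, or
     by refinement it lies mod 0 in another level of castle [n], which is disjoint from [L]. *)
  have [Bj|Bj] := ltP 0%E (mu (B n.+1 j)); last first.
    rewrite (_ : mu _ = 0%E)//; apply/eqP; rewrite -measure_le0.
    rewrite (le_trans _ Bj)// -(mu_level _ _ q) le_measure ?inE//.
    exact: measurableI.
  have [l' [p [cp /andP[pq qp]]]] := (refT n).2 j q Bj qh.
  have [_ _ _ /(_ (q - p)%N)] := cp; rewrite subnKC// => cqp.
  rewrite (_ : mu _ = 0%E)//.
  apply: (@subset_measure0 _ _ _ mu _ (lev n.+1 j q `\` lev n l' (q - p))).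
  - exact: measurableI.
  - exact: measurableD.
  - move=> x [Lx Lx']; split => // Lx''.
    have : (l, g) = (l', (q - p)%N) by apply: level_inj Lx Lx'' => //; lia.
    case=> ll' gE; move: nQ; rewrite /Q /occurs gE leq_subr subKn//=.
    by rewrite ll'; move/asboolP.
  by apply: cqp; lia.
have ltZ : \sum_(p : 'I_k * 'I_(maxh n.+1) | Q' p.1 p.2) b p.1 <= pr Z.
  apply: le_trans
    (sum_levels_le (Q := fun p : 'I_k * 'I__ => Q' p.1 p.2) mZ _); last first.
    by move=> p /andP[Qp _]; exact: Qh.
  apply: ler_sum => -[j q] /= /and3P[/andP[gq /asboolP cq] hq /asboolP cq'].
  have [_ _ _ /(_ g gh)] := cq; rewrite subnK// => sub1.
  have [_ _ _ /(_ g gh)] := cq'; rewrite subnAC subnK; last lia.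
  move=> sub2.
  have sub3 : mu (lev n.+1 j q `\` T (h n l) @` L) = 0%E.
    rewrite -[in lev _ _ q](subnKC (_ : h n l <= q)%N); last by lia.
    rewrite -Zaction_level -(Zaction_imageB actT) (mu_Zaction actT)//.
    exact: measurableD.
  rewrite /b -(mu_level _ _ q) (@prDI _ _ _ mu _ Z)// setIC gerDr.
  rewrite (_ : mu _ = 0%E)// setDIr.
  by rewrite [LHS]measureU0//; exact: measurableD.
have sumE (Q0 : 'I_k -> nat -> bool) :
    \sum_(p : 'I_k * 'I_(maxh n.+1) | Q0 p.1 p.2) b p.1 =
    \sum_j #|[pred q : 'I_(maxh n.+1) | Q0 j q]|%:R * b j.
  rewrite -(pair_big_dep xpredT (fun j q => Q0 j (val q)) (fun j _ => b j)) /=.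
  by apply: eq_bigr => j _; rewrite sumr_const mulr_natl.
rewrite (le_trans leL)// (le_trans _ (ler_wpM2l _ ltZ))//.
rewrite !sumE mulr_sumr; apply: ler_sum => j _.
rewrite mulrA -natrM ler_wpM2r ?pr_ge0// ler_nat.
exact: card_copies_le.
Qed.

(** * Returns of arbitrary sets inside a tower *)

Let tower n i := \bigcup_(g in `I_(h n i)) lev n i g.

Lemma measurable_levels_union n F : measurable (levels_union T B n F).
Proof.
apply: fin_bigcup_measurable => [|j _]; first exact: finite_finset.
by apply: bigcup_measurable => g _.
Qed.

Lemma measurable_tower n i : measurable (tower n i).
Proof. by apply: bigcup_measurable => g _. Qed.

(** Only the levels of [F i] meet tower [i]. Their individual return sets are disjoint and contained
    in the return set of the whole union, so the bounds of [level_return] add up. *)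
Lemma levels_union_return n i (F : 'I_k -> set nat) :
  (forall j, F j `<=` `I_(h n j)) ->
  pr (levels_union T B n F `&` tower n i) <=
  2 * pr (levels_union T B n F `&` T (h n i) @` levels_union T B n F).
Proof.
move=> Fh; set A := levels_union T B n F.
have mA : measurable A by exact: measurable_levels_union.
have mT U : measurable U -> measurable (T (h n i) @` U).
  by move=> mU; exact: (measurable_Zaction actT).
pose P := [pred q : 'I_(h n i) | `[< F i q >]].
pose E (q : 'I_(h n i)) := lev n i q.
pose E' q := E q `&` T (h n i) @` E q.
have mE q : measurable (E q) by exact: measurable_level.
have mE' q : measurable (E' q) by apply: measurableI => //; exact: mT.
have disjE (p q : 'I_(h n i)) x : P p -> P q -> E p x -> E q x -> p = q.
  move=> _ _ Ep Eq; apply: val_inj.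
  by case: (level_inj (ltn_ord p) (ltn_ord q) Ep Eq).
have le1 : pr (A `&` tower n i) <= pr (\bigcup_(q in [set q | P q]) E q).
  apply: le_pr; first by apply: measurableI => //; exact: measurable_tower.
    by apply: fin_bigcup_measurable => //; exact: finite_finset.
  move=> x [[j _ [g Fg Lx]] [g' gh' Lx']].
  have [ji gg'] := level_inj (Fh _ _ Fg) gh' Lx Lx'.
  exists (Ordinal gh'); last exact: Lx'.
  by apply/asboolP => /=; rewrite -ji -gg'.
have le2 : pr (\bigcup_(q in [set q | P q]) E' q) <= pr (A `&` T (h n i) @` A).
  apply: le_pr; last 1 first.
  - apply: bigcup_sub => q /asboolP Fq.
    have EA : E q `<=` A by move=> x Ex; exists i => //; exists q.
    by apply: setISS => //; exact: image_subset.
  - by apply: fin_bigcup_measurable => //; exact: finite_finset.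
  - by apply: measurableI => //; exact: mT.
rewrite (le_trans le1)// (le_trans _ (ler_wpM2l _ le2))//.
rewrite (pr_bigcup_fin mu mE disjE) (pr_bigcup_fin mu mE' _); last first.
  by move=> p q x Pp Pq [Ep _] [Eq _]; exact: disjE Ep Eq.
by rewrite mulr_sumr; apply: ler_sum => q _; exact: level_return.
Qed.

Lemma near_return (A : set X) (e : R) : measurable A -> 0 < e ->
  \forall n \near \oo, forall i,
    pr (A `&` tower n i) <= 2 * pr (A `&` T (h n i) @` A) + e.
Proof.
(* Replacing [A] by a union of levels [A'] costs [A] minus [A'] once and [A'] minus [A] four times
   (factor 2, and two translates), so a total error below [e / 5] suffices. *)
move=> mA e0; have e50 : 0 < e / 5 by rewrite divr_gt0.
have /fine_cvgP[fin /cvgr_lt/(_ _ e50) small] := castle_approx rankT mA.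
near=> n => i.
have [_ [F Fh <-]] : exists2 y, [set mu (A `+` levels_union T B n F) |
    F in [set F : 'I_k -> set nat | forall j, F j `<=` `I_(h n j)]] y &
    (y < (e / 5)%:E)%E.
  apply/ereal_inf_lt; rewrite -[X in (X < _)%E]fineK; last by near: n.
  by rewrite lte_fin; near: n.
have := levels_union_return i Fh.
set A' := levels_union _ _ _ _ => ret AA'.
have mA' : measurable A' by exact: measurable_levels_union.
have mT U : measurable U -> measurable (T (h n i) @` U).
  by move=> mU; exact: (measurable_Zaction actT).
have mY := measurable_tower n i.
have [mAA' mA'A] : measurable (A `\` A') /\ measurable (A' `\` A).
  by split; exact: measurableD.
have {}AA' : pr (A `\` A') + pr (A' `\` A) < e / 5.
  rewrite -prU//; last by rewrite -subset0 => x [[_ ?] []].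
  by rewrite -lte_fin -fine_muK//; exact: measurableU.
have le1 : pr (A `&` tower n i) <= pr (A' `&` tower n i) + pr (A `\` A').
  rewrite (prDI mu (measurableI _ _ mA mY) mA') addrC lerD//.
    by apply: le_pr => [||x [[]]//]; repeat apply: measurableI.
  apply: le_pr => [||x [[]]//]; repeat apply: measurableD => //.
  exact: measurableI.
have le2 : pr (A' `&` T (h n i) @` A') <=
    pr (A `&` T (h n i) @` A) + 2 * pr (A' `\` A).
  have mA'' := mT _ mA'; have mTA := mT _ mA.
  rewrite (prDI mu (measurableI _ _ mA' mA'') (measurableI _ _ mA mTA)) addrC.
  apply: lerD.
    by apply: le_pr => [||x []//]; repeat apply: measurableI.
  apply: (@le_trans _ _ (pr ((A' `\` A) `|` T (h n i) @` (A' `\` A)))).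
    apply: le_pr.
    - by apply: measurableD; apply: measurableI.
    - by apply: measurableU => //; exact: mT.
    - rewrite (Zaction_imageB actT) => x [[A'x TA'x] /not_andP[]].
        by left.
      by right.
  apply: le_trans (pr_leU mu mA'A (mT _ mA'A)) _.
  by rewrite (mu_Zaction actT)// mulr2n mulrDl mul1r.
have := pr_ge0 mu (A `\` A'); have := pr_ge0 mu (A' `\` A).
by move: ret AA' le1 le2 => /=; lra.
Unshelve. all: by end_near. Qed.

(** * Heights, large towers and their almost invariance *)

Lemma ltn_height n j : (0 < mu (B n j))%E -> (0 < h n j)%N -> (n < h n j)%N.
Proof.
elim: n j => [//|n IH] j Bj hj.
have [l [p [cp _]]] := (refT n).2 j 0%N Bj hj.
have [_ hl ph sub] := cp.
(* A non-null level of tower [j] lies mod 0 in the bottom level of tower [l], so the induction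
   hypothesis applies to [l]. *)
have Bl : (0 < mu (B n l))%E.
  rewrite lt0e measure_ge0 andbT -(mu_level n l 0); apply/eqP => L0.
  move: Bj; rewrite -(mu_level _ _ (p + 0)) (_ : mu _ = 0%E) ?ltxx//.
  apply: (@subset_measure0 _ _ _ mu _
    ((lev n.+1 j (p + 0) `\` lev n l 0) `|` lev n l 0)) => //.
  - by apply: measurableU => //; exact: measurableD.
  - by move=> x Lx; have [|] := pselect (lev n l 0 x); [right|left].
  - by rewrite [LHS]measureU0//; [exact: sub|exact: measurableD].
have [q qp cq] := repT cp; have [_ _ qh _] := cq.
(* Two disjoint copies of tower [l] fit into tower [j], so its height is at least [2 * h n l], which
   exceeds [n.+1]. *)
have := IH l Bl hl; wlog pq : p q cp cq qp ph qh {sub} / (p < q)%N.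
  move=> wl; move: (qp) => /eqP; rewrite neq_ltn => /orP[];
    by apply: wl => // /esym.
by have [hq _] := copy_pred cp cq pq; lia.
Qed.

Lemma pr_tower n i : pr (tower n i) = (h n i)%:R * pr (B n i).
Proof.
pose E (q : 'I_(h n i)) := lev n i q.
rewrite (_ : tower n i = \bigcup_(q in [set q | xpredT q]) E q); last first.
  apply/seteqP; split => [x [g gh Lx]|x [g _ Lx]]; first by exists (Ordinal gh).
  by exists g => //=.
rewrite pr_bigcup_fin => [||p q x _ _ Ep Eq].
- under eq_bigr do rewrite mu_level.
  by rewrite sumr_const card_ord mulr_natl.
- by move=> q; exact: measurable_level.
- by apply: val_inj; case: (level_inj (ltn_ord p) (ltn_ord q) Ep Eq).
Qed.

Lemma exists_large_tower n : exists i, k%:R^-1 <= pr (tower n i).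
Proof.
have sum1 : \sum_(i < k) pr (tower n i) = 1.
  rewrite -(@pr_bigcup_fin _ _ _ mu _ xpredT) =>
    [||i j x _ _ [g gh Lx] [g' gh' Lx']].
  - have mU := measurable_levels_union n (fun j => `I_(h n j)).
    rewrite -(prT mu) (prDI mu measurableT mU) setTI setTD.
    rewrite (castle_cover rankT) add0r (_ : [set i | xpredT i] = setT)//.
    exact/seteqP.
  - exact: measurable_tower.
  - by case: (level_inj gh gh' Lx Lx').
apply: contrapT => /forallNP small.
have : \sum_(i < k) pr (tower n i) < \sum_(i < k) k%:R^-1.
  apply: ltr_sum => [|i _]; last by rewrite ltNge; exact/negP.
  (* Strict comparison of sums needs an index; without one the total mass 1 would be an empty
     sum. *)
  apply/hasP; apply: contrapT => none.
  have : (1 : R) != 0 by exact: oner_neq0.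
  rewrite -sum1 big1_seq ?eqxx// => i /andP[_ iI]; exfalso.
  by apply: none; exists i.
rewrite sum1 sumr_const card_ord -[X in _ < X]mulr_natl.
have [->|k0] := posnP k; first by rewrite mul0r ltr10.
by rewrite mulfV ?ltxx// pnatr_eq0 -lt0n.
Qed.

(** The action moves each level to the next, so only the image of the top level can leave the
    tower. *)
Lemma tower_shift n i : pr (T 1 @` tower n i `\` tower n i) <= pr (B n i).
Proof.
have mY := measurable_tower n i; have mTY := measurable_Zaction actT 1 mY.
rewrite -(mu_level n i (h n i)); apply: le_pr => //; first exact: measurableD.
move=> _ [[x [g /= gh Lx] <-]] nY.
have : lev n i (1 + g) (T 1 x) by rewrite -Zaction_level; exists x.
have [->//|gh'] := eqVneq (1 + g)%N (h n i).
by move=> LTx; case: nY; exists (1 + g)%N => //=; lia.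
Qed.

(** * Partial rigidity along heights of large towers *)

Lemma refining_castles_partially_rigid : ergodic_Zaction mu T ->
  partially_rigid mu T.
Proof.
move=> ergT.
have /choice[i iP] := exists_large_tower.
have k0 : 0 < k%:R :> R by rewrite ltr0n; case: k i {iP} => // i; case: (i 0%N).
have tower_gt0 n : 0 < pr (tower n (i n)).
  by apply: lt_le_trans (iP n); rewrite invr_gt0.
pose H n := h n (i n).
have ltnH n : (n < H n)%N.
  apply: ltn_height; last first.
    rewrite lt0n; apply: contraTN (tower_gt0 n) => /eqP h0.
    by rewrite pr_tower h0 mul0r ltxx.
  rewrite lt0e measure_ge0 andbT; apply: contraTN (tower_gt0 n) => /eqP B0.
  by rewrite pr_tower B0 mulr0 ltxx.
have mY n := measurable_tower n (i n).
(* The base of a tower of height [H n] has mass at most [1 / H n], and [n < H n]. *)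
have shift0 :
    (fun n => pr (T 1 @` tower n (i n) `\` tower n (i n))) @ \oo --> 0.
  apply: (squeeze_cvgr _ (cvg_cst 0) (@cvg_harmonic R)).
  apply: nearW => n; rewrite pr_ge0 /= (le_trans (tower_shift _ _))//.
  have : pr (tower n (i n)) <= 1 by rewrite -(prT mu); exact: le_pr.
  rewrite pr_tower /harmonic -ler_pdivlMl; last first.
    by rewrite ltr0n; exact: leq_ltn_trans (ltnH n).
  rewrite mulr1 => /le_trans; apply.
  by rewrite lef_pV2 ?posrE ?ltr0n ?ler_nat//; exact: leq_ltn_trans (ltnH n).
have indep := almost_invariant_independent actT mY ergT shift0.
(* [H] need not be monotone. Iterating it from 0 gives times [H (phi n) = phi n.+1], strictly
   increasing because [m < H m]. *)
pose phi n := iter n H 0%N.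
have phi_ge n : (n <= phi n)%N.
  by elim: n => //= n IH; exact: leq_ltn_trans IH (ltnH _).
exists (2 * k%:R)^-1; first by rewrite invr_gt0 mulr_gt0.
exists (fun n => Posz (H (phi n))) => [n|A mA].
  by rewrite ltz_nat /phi /=; exact: ltnH.
rewrite (fine_muK mu mA) -EFinM; apply/lee_addgt0Pr => e e0.
rewrite -leeBlDr// -EFinB limn_einf_lim.
apply: lime_ge; first exact: is_cvg_einfs.
(* With [Y] the chosen tower, mu(A)/k <= mu(Y) mu(A) < mu(A & Y) + e <= 2 mu(A & T_H A) + 2e;
   halving gives the constant 1/(2k) and the error [e]. *)
have [N _ NP] : \forall n \near \oo,
    (2 * k%:R)^-1 * pr A - e <= pr (A `&` T (H n) @` A).
  near=> n.
  have : `|pr (A `&` tower n (i n)) - pr (tower n (i n)) * pr A| < e.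
    by near: n; move/cvgr0Pnorm_lt: (indep A mA); exact.
  have : pr (A `&` tower n (i n)) <= 2 * pr (A `&` T (H n) @` A) + e.
    by rewrite /H; move: (i n); near: n; exact: near_return.
  have : k%:R^-1 * pr A <= pr (tower n (i n)) * pr A.
    by rewrite ler_wpM2r ?pr_ge0.
  rewrite invfM ltr_norml -mulrA; move: (k%:R^-1 * pr A) => c; lra.
exists N => // n /= Nn; apply: le_ereal_inf_tmp => _ [m /= nm <-].
have mTA := measurable_Zaction actT (H (phi m)) mA.
rewrite (fine_muK mu (measurableI _ _ mA mTA)) lee_fin; apply: NP => /=.
exact: leq_trans (leq_trans Nn nm) (phi_ge m).
Unshelve. all: by end_near. Qed.

End Castle.

Theorem theorem6p6 (R : realType) (d : measure_display) (X : measurableType d)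
    (mu : probability X R) (T : int -> X -> X) (k : nat)
    (B : nat -> 'I_k -> set X) (h : nat -> 'I_k -> nat) :
  standard_borel R X ->
  non_atomic mu ->
  pp_Zaction mu T ->
  ergodic_Zaction mu T ->
  rank_le_without_spacers mu T B h ->
  refining mu T B h ->
  CO_condition mu T B h ->
  copies_repeat mu T B h ->
  partially_rigid mu T.
Proof.
move=> _ _ actT ergT rankT refT coT repT.
exact: refining_castles_partially_rigid actT rankT refT coT repT ergT.
Qed.
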